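(* Let $G$ be a graph and $\tilde G$ its suspension. We have $\nu(\tilde G)<1$ if and only if $G$ contains an isolated vertex. Moreover, we have $0<\nu(\tilde G)<1$ if and only if $G$ contains both an isolated vertex and at least one edge.
   Context: All graphs $G=(V,E)$ are finite and simple with nonempty vertex set; $x\sim y$ denotes adjacency. $E^{or}(G)$ is the set of ordered pairs $(x,y)$ with $x\sim y$. A magnetic potential is a map $\sigma:E^{or}(G)\to S^1=\{z\in\mathbb{C}:|z|=1\}$ with $\sigma(y,x)=\sigma(x,y)^{-1}$. The magnetic Laplacian on functions $f:V\to\mathbb{C}$ is $\Delta^\sigma f(x)=\sum_{y\sim x}(f(x)-\sigma(x,y)f(y))$, and $\lambda_1^\sigma(G)$ is its smallest eigenvalue. The magneto-spectral height is $\nu(G)=\sup_\sigma\lambda_1^\sigma(G)$, over all magnetic potentials on $G$. The suspension $\tilde G$ of $G$ is obtained from $G$ by adding one new vertex and connecting it to all vertices of $G$. *)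

(* Defs.v *)
From HB Require Import structures.
From mathcomp Require Import all_boot all_order all_algebra.
From mathcomp Require Import all_classical all_reals.
From mathcomp Require Import complex.

Set Implicit Arguments.
Unset Strict Implicit.
Unset Printing Implicit Defensive.

Import Order.TTheory GRing.Theory Num.Theory.
Local Open Scope classical_set_scope.
Local Open Scope complex_scope.
Local Open Scope ring_scope.

(* A finite simple graph is a finType [T] of vertices with a symmetric and
   irreflexive adjacency relation [e : rel T]. *)

Definition isolated (T : finType) (e : rel T) (x : T) : Prop :=
  forall y : T, ~~ e x y.

(* The new vertex is [None]. *)
Definition suspension (T : finType) (e : rel T) : rel (option T) :=
  fun u v =>
    match u, v with
    | Some x, Some y => e x y
    | None, None => false
    | _, _ => true
    end.

Lemma suspension_sym (T : finType) (e : rel T) :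
  symmetric e -> symmetric (suspension e).
Proof. by move=> es [x|] [y|] //=; exact: es. Qed.

Lemma suspension_irr (T : finType) (e : rel T) :
  irreflexive e -> irreflexive (suspension e).
Proof. by move=> ei [x|] //=; exact: ei. Qed.

Section MagneticLaplacian.
Variables (R : realType) (T : finType) (e : rel T).

(* A potential lives on ordered pairs of adjacent vertices: [s] is total, but
   its values on non-adjacent pairs are unconstrained and never used. *)
Definition magnetic_potential (s : T -> T -> R[i]) : Prop :=
  forall x y : T, e x y -> `|s x y| = 1 /\ s y x = (s x y)^-1.

Definition magnetic_laplacian (s : T -> T -> R[i]) (f : {ffun T -> R[i]}) :
    {ffun T -> R[i]} :=
  [ffun x => \sum_(y | e x y) (f x - s x y * f y)].

Definition magnetic_eigenvalue (s : T -> T -> R[i]) (l : R) : Prop :=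
  exists f : {ffun T -> R[i]},
    f != 0 /\ forall x : T, magnetic_laplacian s f x = l%:C * f x.

(* For a potential on a nonempty simple graph the Laplacian is Hermitian, so
   its spectrum is a finite nonempty set of reals and this infimum is its
   least element. *)
Definition lambda1 (s : T -> T -> R[i]) : R :=
  inf [set l : R | magnetic_eigenvalue s l].

(* The set is nonempty (constant potential 1) and bounded above (by the mean
   degree), so the real supremum is not a default value. *)
Definition magneto_spectral_height : R :=
  sup [set lambda1 s | s in [set s | magnetic_potential s]].

End MagneticLaplacian.

Arguments magneto_spectral_height R {T} e.

(* Main.v *)
Require Import Defs.
From HB Require Import structures.
From mathcomp Require Import all_boot all_order all_algebra.
From mathcomp Require Import all_classical all_reals.
From mathcomp Require Import complex.
From mathcomp Require Import ring lra zify.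

Set Implicit Arguments.
Unset Strict Implicit.
Unset Printing Implicit Defensive.

Import Order.TTheory GRing.Theory Num.Theory.
Local Open Scope ring_scope.

(** Write n for the number of vertices of G and o for the suspension vertex. By
    the spectral theorem the smallest eigenvalue of the magnetic Laplacian is
    the minimum over f of energy / (2 |f|^2), where the energy sums
    |f x - s x y * f y|^2 over ordered edges, so each undirected edge is counted
    twice ([lambda1P]). Both bounds on the height are then statements about
    energies.

    If x is isolated in G, it is a leaf of the suspension, attached to o. The
    function equal to n at x and to s(o, x) at o does not see the potential,
    since a single edge carries no flux; its Rayleigh quotient
    n (n - 1) / (n^2 + 1) is below 1 and independent of the potential, so the
    supremum is below 1 as well ([suspension_lambda1_isolated]).

    If G has no isolated vertex, put the value 1 on the edges at o. With
    c = f o, S the sum of f over G and E the energy of f on G, the inequality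
    energy >= 2 |f|^2 on the suspension reads
      (n - 1) |c|^2 - 2 Re (c^* S) + E / 2 >= 0,
    and it follows from |S|^2 <= (n - 1) E / 2 by completing a square
    ([no_isolated_suspension_height_ge1]). A potential on G with this last
    property comes from an edge cover F with at most n - 1 edges: at each vertex
    x pick unit complex numbers u x y, one for each F-neighbour y, with sum 1.
    Then S is the sum over the edges xy of F of u x y * f x + u y x * f y. With
    s x y = - u y x / u x y each summand has modulus |f x - s x y * f y|, and
    Cauchy-Schwarz concludes ([exists_sum_le_energy]).

    For positivity, a suspension of an edgeless graph is a star, on which every
    potential is a gauge transform of the trivial one and 0 is an eigenvalue,
    whereas an edge of G closes a triangle with o, and a potential with flux -1
    through that triangle leaves no nonzero function of energy 0. *)

(** * Least eigenvalue of a Hermitian operator *)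

(** In an orthonormal eigenbasis the form w A w^* is a combination of the
    |coordinate|^2 with the eigenvalues as weights, so replacing every weight by
    the least one gives a lower bound. Vectors are rows, acted on from the
    right. *)
Lemma hermitian_mx_least_eigenvalue (C : numClosedFieldType) (n : nat)
    (A : 'M[C]_n) :
  (0 < n)%N -> (forall i j, A j i = (A i j)^*) ->
  exists (l : C) (v : 'rV[C]_n),
    [/\ l \is Num.real, v != 0, v *m A = l *: v &
        forall w : 'rV[C]_n,
          l * \sum_i `|w 0 i| ^+ 2 <= \sum_j (w *m A) 0 j * (w 0 j)^*].
Proof.
move=> n_gt0 A_herm.
have A_sym : A \is hermsymmx.
  apply/is_hermitianmxP; rewrite expr0 scale1r.
  by apply/matrixP => i j; rewrite !mxE -A_herm.
have A_normal := hermitian_normalmx A_sym.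
have D_real i : spectral_diag A 0 i \is Num.real.
  by have /mxOverP := hermitian_spectral_diag_real A_sym; apply.
have PU := spectral_unitarymx A.
have /orthomx_spectralP AE := A_normal.
move: PU AE D_real; rewrite /=.
set P := spectralmx A; set D := spectral_diag A => PU AE D_real.
rewrite invmx_unitary // in AE.
have [i _ i_min] := @real_arg_minP C 'I_n (Ordinal n_gt0) xpredT
  (fun i => D 0 i) isT (fun i _ => D_real i).
have PA : P *m A = diag_mx D *m P.
  by rewrite {1}AE !mulmxA (unitarymxP PU) mul1mx.
exists (D 0 i), (row i P); split => //.
- apply/eqP => rowP0.
  have /row_unitarymxP/(_ i i) := PU.
  by rewrite rowP0 linear0l eqxx => /eqP; rewrite eq_sym oner_eq0.
- by rewrite -row_mul PA; apply/rowP => j; rewrite mul_diag_mx !mxE.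
move=> w.
have dotE (u v : 'rV[C]_n) :
    \sum_j u 0 j * (v 0 j)^* = (u *m map_mx Num.conj v^T) 0 0.
  by rewrite mxE; apply: eq_bigr => j _; rewrite !mxE.
(* the coordinates of [w] in the eigenbasis formed by the rows of [P] *)
pose z := w *m map_mx Num.conj P^T.
have wE : w = z *m P by rewrite /z mulmxKtV.
have normE : \sum_i `|w 0 i| ^+ 2 = \sum_i `|z 0 i| ^+ 2.
  under eq_bigr do rewrite normCK; under [RHS]eq_bigr do rewrite normCK.
  by rewrite !dotE {1 2}wE trmx_mul map_mxM mulmxA mulmxtVK.
have formE : \sum_j (w *m A) 0 j * (w 0 j)^* = \sum_j D 0 j * `|z 0 j| ^+ 2.
  rewrite dotE wE -(mulmxA z P A) PA mulmxA trmx_mul map_mxM mulmxA.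
  rewrite mulmxtVK // -dotE; apply: eq_bigr => j _.
  by rewrite mul_mx_diag mxE normCK; ring.
rewrite normE formE mulr_sumr; apply: ler_sum => j _.
by rewrite ler_wpM2r ?exprn_ge0 // i_min.
Qed.

(** The same over an arbitrary finite index type, with operators acting on
    functions; [A] below is transposed because rows are acted on from the
    right. *)
Lemma hermitian_least_eigenvalue (C : numClosedFieldType) (T : finType)
    (a : T -> T -> C) :
  (0 < #|T|)%N -> (forall x y, a y x = (a x y)^*) ->
  exists (l : C) (f : {ffun T -> C}),
    [/\ l \is Num.real, f != 0, forall x, \sum_y a x y * f y = l * f x &
        forall g : T -> C,
          l * \sum_x `|g x| ^+ 2 <= \sum_x (g x)^* * \sum_y a x y * g y].
Proof.
move=> T_gt0 a_herm.
have sumE (F : T -> C) : \sum_x F x = \sum_(i < #|T|) F (enum_val i).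
  by rewrite -big_enum_val.
pose A : 'M[C]_#|T| := \matrix_(i, j) a (enum_val j) (enum_val i).
have A_herm i j : A j i = (A i j)^* by rewrite !mxE -a_herm.
have AE (w : 'rV_#|T|) j : (w *m A) 0 j =
    \sum_y a (enum_val j) y * w 0 (enum_rank y).
  by rewrite sumE mxE; apply: eq_bigr => k _; rewrite mxE enum_valK mulrC.
have [l [v [l_real v_neq0 vE l_min]]] :=
  hermitian_mx_least_eigenvalue T_gt0 A_herm.
exists l, [ffun x => v 0 (enum_rank x)]; split => //.
- apply: contraNneq v_neq0 => /ffunP f0; apply/eqP/rowP => i.
  by have := f0 (enum_val i); rewrite !ffunE enum_valK !mxE.
- move=> x; under eq_bigr do rewrite ffunE.
  by have := AE v (enum_rank x); rewrite enum_rankK vE mxE ffunE => <-.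
move=> g; have := l_min (\row_i g (enum_val i)).
rewrite !sumE; under eq_bigr do rewrite mxE.
move=> /le_trans; apply; rewrite le_eqVlt; apply/orP; left; apply/eqP.
apply: eq_bigr => i _; rewrite AE [X in X^*]mxE mulrC; congr (_ * _).
by apply: eq_bigr => y _; rewrite mxE enum_rankK.
Qed.

(** * Energy and the Rayleigh principle *)

(** Ordered edges are used to avoid choosing orientations; this is twice the
    usual quadratic form of the magnetic Laplacian. *)
Definition magnetic_energy (R : realType) (T : finType) (e : rel T)
    (s : T -> T -> R[i]) (f : T -> R[i]) : R[i] :=
  \sum_x \sum_(y | e x y) `|f x - s x y * f y| ^+ 2.

Lemma magnetic_energy_ge0 (R : realType) (T : finType) (e : rel T)
    (s : T -> T -> R[i]) (f : T -> R[i]) : 0 <= magnetic_energy e s f.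
Proof. by do 2![apply: sumr_ge0 => ? _]; rewrite exprn_ge0. Qed.

Lemma sum_edges_swap (V : nmodType) (T : finType) (e : rel T)
    (F : T -> T -> V) :
  symmetric e ->
  \sum_x \sum_(y | e x y) F y x = \sum_x \sum_(y | e x y) F x y.
Proof.
move=> e_sym; rewrite (exchange_big_dep xpredT) //=.
by apply: eq_bigr => x _; apply: eq_bigl => y; rewrite e_sym.
Qed.

Lemma magnetic_potential_conj (R : realType) (T : finType) (e : rel T)
    (s : T -> T -> R[i]) (x y : T) :
  magnetic_potential e s -> e x y -> s y x = (s x y)^*.
Proof.
move=> s_pot /s_pot[s1 ->].
by rewrite invC_norm s1 expr1n invr1 mul1r.
Qed.

(** Green's formula: expanding a square over the edge xy gives the contribution
    of (x, y) to the right-hand side plus that of (y, x). *)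
Lemma magnetic_energyE (R : realType) (T : finType) (e : rel T)
    (s : T -> T -> R[i]) (f : T -> R[i]) :
  symmetric e -> magnetic_potential e s ->
  magnetic_energy e s f =
  (\sum_x (f x)^* * \sum_(y | e x y) (f x - s x y * f y)) *+ 2.
Proof.
move=> e_sym s_pot; under [in RHS]eq_bigr do rewrite mulr_sumr.
rewrite mulr2n -{2}sum_edges_swap // -big_split /=; apply: eq_bigr => x _.
rewrite -big_split /=; apply: eq_bigr => y exy.
rewrite normCK rmorphB rmorphM /= -(magnetic_potential_conj s_pot exy).
have [s1 syx] := s_pot _ _ exy.
have s_neq0 : s x y != 0 by rewrite -normr_gt0 s1.
by rewrite syx; field.
Qed.

Lemma ffun_neq0 (V : nmodType) (T : finType) (f : {ffun T -> V}) :
  f != 0 -> exists x, f x != 0.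
Proof.
move=> f_neq0; apply/existsP; apply: contraNT f_neq0 => /existsPn f0.
by apply/eqP/ffunP => x; rewrite ffunE; apply/eqP; have := f0 x; rewrite negbK.
Qed.

Lemma sum_sqr_norm_gt0 (R : realType) (T : finType) (f : T -> R[i]) (x : T) :
  f x != 0 -> 0 < \sum_y `|f y| ^+ 2.
Proof.
move=> fx; rewrite (bigD1 x) //= ltr_pwDl ?exprn_gt0 ?normr_gt0 //.
by apply: sumr_ge0 => ? _; rewrite exprn_ge0.
Qed.

Lemma magnetic_energy_eigen (R : realType) (T : finType) (e : rel T)
    (s : T -> T -> R[i]) (l : R) (f : {ffun T -> R[i]}) :
  symmetric e -> magnetic_potential e s ->
  (forall x, magnetic_laplacian e s f x = l%:C%C * f x) ->
  magnetic_energy e s f = l%:C%C * (\sum_x `|f x| ^+ 2) *+ 2.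
Proof.
move=> e_sym s_pot fE; rewrite magnetic_energyE //; congr (_ *+ 2).
rewrite mulr_sumr; apply: eq_bigr => x _.
by have := fE x; rewrite ffunE => ->; rewrite normCK; ring.
Qed.

(** Rayleigh's principle. The Laplacian is a Hermitian operator, so its least
    eigenvalue is attained, and the infimum defining [lambda1] is that least
    eigenvalue. *)
Lemma lambda1P (R : realType) (T : finType) (e : rel T) (s : T -> T -> R[i]) :
  (0 < #|T|)%N -> symmetric e -> magnetic_potential e s ->
  magnetic_eigenvalue e s (lambda1 e s) /\
  forall f : T -> R[i],
    (lambda1 e s)%:C%C * (\sum_x `|f x| ^+ 2) *+ 2 <= magnetic_energy e s f.
Proof.
move=> T_gt0 e_sym s_pot.
(* the kernel of the Laplacian: degree on the diagonal, -s x y on edges *)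
pose a x y : R[i] :=
  (x == y)%:R * (\sum_(z | e x z) 1) - (e x y)%:R * s x y.
have a_herm x y : a y x = (a x y)^*.
  have sE : (e y x)%:R * s y x = ((e x y)%:R * s x y)^*.
    rewrite e_sym; case exy: (e x y); rewrite ?mul0r ?rmorph0 // !mul1r.
    exact: magnetic_potential_conj exy.
  rewrite /a rmorphB /= -sE eq_sym; congr (_ - _).
  case: eqVneq => [->|_]; last by rewrite !mul0r rmorph0.
  by rewrite mul1r sumr_const conjC_nat.
have aE (f : T -> R[i]) x :
    \sum_y a x y * f y = \sum_(y | e x y) (f x - s x y * f y).
  under eq_bigr do rewrite mulrBl; rewrite !sumrB; congr (_ - _).
    rewrite (bigD1 x) //= eqxx mul1r [X in _ + X]big1 => [|y /negPf].
      by rewrite addr0 mulr_suml; apply: eq_bigr => y _; rewrite mul1r.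
    by rewrite eq_sym => ->; rewrite !mul0r.
  rewrite [RHS]big_mkcond /=; apply: eq_bigr => y _.
  by case: (e x y); rewrite ?mul1r ?mul0r.
have [m [f [m_real f_neq0 fE m_min]]] :=
  hermitian_least_eigenvalue T_gt0 a_herm.
pose l : R := complex.Re m.
have mE : m = l%:C%C by rewrite RRe_real.
have l_eig : magnetic_eigenvalue e s l.
  by exists f; split => // x; rewrite ffunE -aE fE mE.
have l_min (g : T -> R[i]) :
    l%:C%C * (\sum_x `|g x| ^+ 2) *+ 2 <= magnetic_energy e s g.
  rewrite magnetic_energyE // lerMn2r /= -mE (le_trans (m_min g)) //.
  by rewrite le_eqVlt (eq_bigr _ (fun x _ => congr1 _ (aE g x))) eqxx.
suff -> : lambda1 e s = l by [].
have l_lb : lbound [set k | magnetic_eigenvalue e s k]%classic l.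
  move=> k [g [g_neq0 gE]]; have := l_min g.
  have [x gx] := ffun_neq0 g_neq0.
  rewrite (magnetic_energy_eigen _ _ gE) // lerMn2r /=.
  by rewrite ler_pM2r ?lecR // (sum_sqr_norm_gt0 gx).
apply/eqP; rewrite eq_le; apply/andP; split.
  by apply: ge_inf => //; exists l.
by apply: lb_le_inf => //; exists l.
Qed.

Lemma lambda1_attained (R : realType) (T : finType) (e : rel T)
    (s : T -> T -> R[i]) :
  (0 < #|T|)%N -> symmetric e -> magnetic_potential e s ->
  exists f : T -> R[i], 0 < \sum_x `|f x| ^+ 2 /\
    magnetic_energy e s f = (lambda1 e s)%:C%C * (\sum_x `|f x| ^+ 2) *+ 2.
Proof.
move=> T_gt0 e_sym s_pot.
have [[f [f_neq0 fE]] _] := lambda1P T_gt0 e_sym s_pot.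
exists f; split; last exact: magnetic_energy_eigen fE.
by have [x] := ffun_neq0 f_neq0; apply: sum_sqr_norm_gt0.
Qed.

Lemma lambda1_le (R : realType) (T : finType) (e : rel T)
    (s : T -> T -> R[i]) (c : R) (f : T -> R[i]) :
  (0 < #|T|)%N -> symmetric e -> magnetic_potential e s ->
  0 < \sum_x `|f x| ^+ 2 ->
  magnetic_energy e s f <= c%:C%C * (\sum_x `|f x| ^+ 2) *+ 2 ->
  lambda1 e s <= c.
Proof.
move=> T_gt0 e_sym s_pot f_gt0 /(le_trans ((lambda1P T_gt0 e_sym s_pot).2 f)).
by rewrite lerMn2r /= ler_pM2r // lecR.
Qed.

Lemma lambda1_ge (R : realType) (T : finType) (e : rel T)
    (s : T -> T -> R[i]) (c : R) :
  (0 < #|T|)%N -> symmetric e -> magnetic_potential e s ->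
  (forall f : T -> R[i],
     c%:C%C * (\sum_x `|f x| ^+ 2) *+ 2 <= magnetic_energy e s f) ->
  c <= lambda1 e s.
Proof.
move=> T_gt0 e_sym s_pot c_le.
have [f [f_gt0 fE]] := lambda1_attained T_gt0 e_sym s_pot.
by have := c_le f; rewrite fE lerMn2r /= ler_pM2r // lecR.
Qed.

(** A zero eigenvalue would come with an eigenvector of energy 0, that is,
    satisfying f x = s x y * f y along every edge. *)
Lemma lambda1_gt0 (R : realType) (T : finType) (e : rel T)
    (s : T -> T -> R[i]) :
  (0 < #|T|)%N -> symmetric e -> magnetic_potential e s ->
  (forall f : T -> R[i], (forall x y, e x y -> f x = s x y * f y) ->
     forall x, f x = 0) ->
  0 < lambda1 e s.
Proof.
move=> T_gt0 e_sym s_pot s_def.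
have [f [f_gt0 fE]] := lambda1_attained T_gt0 e_sym s_pot.
have l_ge0 : 0 <= lambda1 e s.
  apply: lambda1_ge => // g.
  by rewrite rmorph0 mul0r mul0rn magnetic_energy_ge0.
rewrite lt_neqAle l_ge0 andbT; apply/eqP => l0.
suff f0 : forall x, f x = 0.
  by move: f_gt0; rewrite big1 ?ltxx // => x _; rewrite f0 normr0 expr0n.
apply: s_def => x y exy; apply/eqP; rewrite -subr_eq0 -normr_eq0 -sqrf_eq0.
move: fE; rewrite -l0 rmorph0 mul0r mul0rn => /eqP.
rewrite psumr_eq0 => [/allP/(_ x)|z _]; last first.
  by apply: sumr_ge0 => ? _; rewrite exprn_ge0.
rewrite mem_index_enum => /(_ isT)/=.
rewrite psumr_eq0 => [/allP/(_ y)|z _]; last by rewrite exprn_ge0.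
by rewrite mem_index_enum exy => /(_ isT).
Qed.

Lemma height_le (R : realType) (T : finType) (e : rel T) (c : R) :
  (forall s : T -> T -> R[i], magnetic_potential e s -> lambda1 e s <= c) ->
  magneto_spectral_height R e <= c.
Proof.
move=> le_c; apply: ge_sup => [|_ [s s_pot <-]]; last exact: le_c.
exists (lambda1 e (fun _ _ => 1 : R[i])), (fun _ _ => 1) => // x y _.
by rewrite normr1 invr1.
Qed.

(** The constant function 1 bounds [lambda1] by twice the number of vertices for
    every potential, which makes the supremum a genuine one. *)
Lemma height_ge (R : realType) (T : finType) (e : rel T)
    (s : T -> T -> R[i]) :
  (0 < #|T|)%N -> symmetric e -> magnetic_potential e s ->
  lambda1 e s <= magneto_spectral_height R e.
Proof.
move=> T_gt0 e_sym s_pot; apply: ub_le_sup; last by exists s.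
exists (2 * #|T|%:R) => _ [t t_pot <-].
have normE : \sum_(x : T) `|1 : R[i]| ^+ 2 = #|T|%:R.
  by rewrite normr1 expr1n sumr_const.
apply: (lambda1_le (f := fun _ => 1)); rewrite ?normE ?ltr0n //.
have -> : (2 * #|T|%:R)%:C%C * #|T|%:R *+ 2 =
    \sum_(x : T) \sum_(y : T) (4 : R[i]).
  rewrite !sumr_const rmorphM /= !rmorph_nat -[4 *+ _]mulr_natr.
  by rewrite -[_ *+ #|_|]mulr_natr; ring.
apply: ler_sum => x _; rewrite big_mkcond /=; apply: ler_sum => y _.
case: ifP => // exy; have [t1 _] := t_pot _ _ exy.
have -> : 4 = (1 + 1) ^+ 2 :> R[i] by ring.
rewrite lerXn2r ?nnegrE ?addr_ge0 ?normr_ge0 // mulr1.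
by rewrite (le_trans (ler_normB _ _)) // normr1 t1.
Qed.

(** * Suspensions with an isolated vertex *)

Lemma big_option (V : nmodType) (T : finType) (F : option T -> V) :
  \sum_u F u = F None + \sum_x F (Some x).
Proof.
rewrite (bigD1 None) //=; congr (_ + _).
rewrite (reindex_omap Some id) => [|[]] //.
by apply: eq_bigl => x; rewrite /= eqxx.
Qed.

(** The two orientations of a suspension edge contribute equally, because
    s(o, x) s(x, o) = 1; the other edges are those of the graph itself. *)
Lemma suspension_energyE (R : realType) (T : finType) (e : rel T)
    (s : option T -> option T -> R[i]) (f : option T -> R[i]) :
  magnetic_potential (suspension e) s ->
  magnetic_energy (suspension e) s f =
  (\sum_x `|f (Some x) - s (Some x) None * f None| ^+ 2) *+ 2 +
  magnetic_energy e (fun x y => s (Some x) (Some y)) (fun x => f (Some x)).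
Proof.
move=> s_pot; rewrite /magnetic_energy.
under eq_bigr do rewrite big_mkcond /= big_option /=.
rewrite big_option /= add0r big_split /= addrA; congr (_ + _); last first.
  by apply: eq_bigr => x _; rewrite -big_mkcond.
rewrite mulr2n; congr (_ + _); apply: eq_bigr => x _.
have [s1 ->] := s_pot (Some x) None isT.
have s_neq0 : s (Some x) None != 0 by rewrite -normr_gt0 s1.
rewrite -[RHS]mul1r -(expr1n _ 2) -{1}[1]invr1 -s1 -normfV -exprMn -normrM.
by rewrite distrC; congr (`|_| ^+ 2); field.
Qed.

Lemma card_suspension_gt0 (T : finType) : (0 < #|{: option T}|)%N.
Proof. by rewrite card_option. Qed.

(** The test function is an almost optimal one for the 2 by 2 block of the
    Laplacian on the isolated vertex and the suspension vertex; the edges from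
    the latter to the other n - 1 vertices contribute 1 each. *)
Lemma suspension_lambda1_isolated (R : realType) (T : finType) (e : rel T)
    (s : option T -> option T -> R[i]) (x : T) :
  symmetric e -> isolated e x -> magnetic_potential (suspension e) s ->
  lambda1 (suspension e) s <=
  #|T|%:R * (#|T|%:R - 1) / (#|T|%:R ^+ 2 + 1).
Proof.
move=> e_sym x_iso s_pot.
pose n : R[i] := #|T|%:R.
pose f (u : option T) : R[i] :=
  if u is Some y then if y == x then n else 0 else s None (Some x).
have [so1 sxE] := s_pot None (Some x) isT.
have soK : s (Some x) None * s None (Some x) = 1.
  by rewrite sxE mulrC divff // -normr_gt0 so1.
have card_but_x : \sum_(y | y != x) (1 : R[i]) = n - 1.
  have -> : n = \sum_(y : T) 1 by rewrite sumr_const.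
  by rewrite [X in _ = X - 1](bigD1 x) //=; ring.
have normE : \sum_u `|f u| ^+ 2 = n ^+ 2 + 1.
  rewrite big_option /= so1 expr1n addrC (bigD1 x) //= eqxx normr_nat.
  rewrite [X in _ + X + _]big1 ?addr0 // => y /negPf->.
  by rewrite normr0 expr0n.
have n2_gt0 : 0 < n ^+ 2 + 1 by rewrite ltr_wpDl ?exprn_ge0 ?ler0n.
apply: (lambda1_le (f := f) (card_suspension_gt0 T) _ s_pot).
- exact: suspension_sym.
- by rewrite normE.
rewrite normE suspension_energyE // /magnetic_energy.
rewrite [X in _ + X]big1 => [|y _]; last first.
  apply: big1 => z eyz; rewrite /= !ifN ?mulr0 ?subr0 ?normr0 ?expr0n //.
    by apply: contraL eyz => /eqP->; rewrite e_sym; apply: x_iso.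
  by apply: contraL eyz => /eqP->; apply: x_iso.
rewrite (bigD1 x) //= eqxx soK.
rewrite (eq_bigr (fun=> 1)) => [|y /negPf yx]; last first.
  have [sy1 _] := s_pot (Some y) None isT.
  by rewrite yx sub0r normrN normrM sy1 so1 mulr1 expr1n.
rewrite card_but_x addr0 real_normK ?realB ?realn //.
rewrite lerMn2r /= rmorphM rmorphM fmorphV rmorphB rmorphD rmorphXn rmorph1 /=.
rewrite !rmorph_nat -/n divfK ?gt_eqF // le_eqVlt; apply/orP; left.
by apply/eqP; ring.
Qed.

Lemma isolated_suspension_height_lt1 (R : realType) (T : finType) (e : rel T)
    (x : T) :
  symmetric e -> isolated e x -> magneto_spectral_height R (suspension e) < 1.
Proof.
move=> e_sym x_iso; apply: le_lt_trans (height_le _) _ => [s s_pot|].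
  exact: suspension_lambda1_isolated x_iso s_pot.
rewrite ltr_pdivrMr ?mul1r; last by rewrite ltr_wpDl ?exprn_ge0 ?ler0n.
have n_ge0 : 0 <= #|T|%:R :> R by rewrite ler0n.
by lra.
Qed.

(** * Suspensions without isolated vertices *)

(** One unit number: 1. Two: a primitive sixth root of unity and its inverse.
    Appending 1 and -1 keeps the sum, so all sizes follow by steps of two. *)
Lemma unit_norm_sum1 (C : numClosedFieldType) (d : nat) :
  (0 < d)%N ->
  exists w : nat -> C, (forall k, `|w k| = 1) /\ \sum_(k < d) w k = 1.
Proof.
case: d => // d _.
suff : (exists w : nat -> C, (forall k, `|w k| = 1) /\ \sum_(k < d.+1) w k = 1)
    /\ (exists w : nat -> C, (forall k, `|w k| = 1) /\ \sum_(k < d.+2) w k = 1).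
  by case.
elim: d => [|d [[w [w1 wS]] IH2]]; split => //.
- exists (fun=> 1); split => [_|]; first exact: normr1.
  by rewrite big_ord1.
- (* as z^2 = z - 1, z is a primitive sixth root of unity and 1 - z = -z^2 *)
  have [z zE] := @solve_monicpoly C 2 (fun i => if i is 0 then -1 else 1) isT.
  rewrite !big_ord_recl big_ord0 /= expr0 expr1 addr0 mulr1 mul1r in zE.
  have z3 : z ^+ 3 = -1.
    by rewrite exprS zE mulrDr -expr2 zE; ring.
  have z1 : `|z| = 1.
    by apply/eqP; rewrite -(@pexpr_eq1 C `|z| 3) // -normrX z3 normrN normr1.
  exists (fun k => if k is 0 then z else - z ^+ 2); split.
    by case=> [|k] //; rewrite normrN normrX z1 expr1n.
  by rewrite !big_ord_recl big_ord0 /= zE; ring.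
- exists (fun k => if k is k'.+2 then w k' else (-1) ^+ k); split.
    by case=> [|[|k]] //=; rewrite ?expr0 ?expr1 ?normrN normr1.
  by rewrite !(big_ord_recl d.+2) big_ord_recl /= wS expr0 expr1; ring.
Qed.

Lemma unit_norm_sum1_set (C : numClosedFieldType) (T : finType) (A : {pred T}) :
  (0 < #|A|)%N ->
  exists u : T -> C, (forall x, `|u x| = 1) /\ \sum_(x in A) u x = 1.
Proof.
move=> /(unit_norm_sum1 C)[w [w1 wS]].
exists (fun x => w (index x (enum A))); split => //.
rewrite big_enum_val -[RHS]wS; apply: eq_bigr => i _.
by rewrite (enum_val_nth (enum_default i)) index_uniq ?enum_uniq // -cardE.
Qed.

(** Cauchy-Schwarz against the constant vector, obtained from the variance of
    the moduli being nonnegative. *)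
Lemma sqr_norm_sum_le (C : numClosedFieldType) (I : finType) (P : pred I)
    (z : I -> C) :
  `|\sum_(i | P i) z i| ^+ 2 <= #|P|%:R * \sum_(i | P i) `|z i| ^+ 2.
Proof.
pose S := \sum_(i | P i) `|z i|; pose m : C := #|P|%:R.
have S_ge0 : 0 <= S by apply: sumr_ge0.
apply: (@le_trans _ _ (S ^+ 2)).
  by rewrite lerXn2r ?nnegrE //; apply: ler_norm_sum.
have [P0|P_gt0] := posnP #|P|.
  by rewrite /S !big_pred0 ?expr0n ?mulr0 // => i; apply: card0_eq.
have m_gt0 : 0 < m by rewrite ltr0n.
rewrite -/m -subr_ge0 -(pmulr_rge0 _ m_gt0).
suff -> : m * (m * (\sum_(i | P i) `|z i| ^+ 2) - S ^+ 2) =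
    \sum_(i | P i) (m * `|z i| - S) ^+ 2.
  apply: sumr_ge0 => i _; rewrite real_exprn_even_ge0 //.
  by rewrite realB ?realM ?ger0_real ?(ltW m_gt0).
under [RHS]eq_bigr do rewrite sqrrB exprMn.
rewrite big_split sumrB /= -mulr_sumr sumrMnl -mulr_suml -mulr_sumr -/S.
by rewrite sumr_const -[_ *+ #|_|]mulr_natr -/m; ring.
Qed.

(** Joining every vertex x to a neighbour p x covers all vertices with at most
    #|T| edges. Making a and b point at each other produces the edge ab twice,
    which saves one edge. Ordered edges are counted, hence the factor two. *)
Lemma small_edge_cover (T : finType) (e : rel T) (a b : T) :
  symmetric e -> irreflexive e -> (forall x, exists y, e x y) -> e a b ->
  exists F : rel T, [/\ symmetric F, subrel F e, forall x, (0 < #|F x|)%N &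
    (#|[pred z : T * T | F z.1 z.2]| <= #|T|.-1.*2)%N].
Proof.
move=> e_sym e_irr e_nbr eab.
have [q eq_] := choice e_nbr.
pose p x := if x == a then b else if x == b then a else q x.
have ab : a != b by apply: contraTneq eab => ->; rewrite e_irr.
have pa : p a = b by rewrite /p eqxx.
have pb : p b = a by rewrite /p eq_sym (negPf ab) eqxx.
have ep x : e x (p x).
  by rewrite /p; case: eqVneq => [->|_] //; case: eqVneq => [->|_] //;
     rewrite e_sym.
exists (fun x y => (p x == y) || (p y == x)); split.
- by move=> x y; rewrite orbC.
- by move=> x y /orP[] /eqP <- //; rewrite e_sym.
- by move=> x; apply/card_gt0P; exists (p x); rewrite unfold_in eqxx.
pose G1 := [set (x, p x) | x : T]; pose G2 := [set (p x, x) | x : T].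
rewrite (@leq_trans #|G1 :|: G2|) //.
  apply: subset_leq_card; apply/fintype.subsetP => -[x y].
  rewrite !inE /= => /orP[]/eqP <-.
    by rewrite imset_f.
  by rewrite orbC imset_f.
have cardI : (2 <= #|G1 :&: G2|)%N.
  have <- : #|[set (a, b); (b, a)]| = 2%N.
    by rewrite cards2 xpair_eqE (negPf ab).
  apply: subset_leq_card; apply/fintype.subsetP => z.
  rewrite !inE => /orP[]/eqP->.
    by apply/andP; split; apply/imsetP; [exists a|exists b]; rewrite ?pa ?pb.
  by apply/andP; split; apply/imsetP; [exists b|exists a]; rewrite ?pa ?pb.
have card1 : (#|G1| <= #|T|)%N by exact: leq_imset_card.
have card2 : (#|G2| <= #|T|)%N by exact: leq_imset_card.
rewrite cardsU -addnn; lia.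
Qed.

(** In the dual picture the sum of f over the vertices is written as a
    combination, with unit coefficients, of the differences f x - s x y * f y on
    a small edge cover. At each vertex the coefficients on the covering edges
    must sum to 1; the phases at the two ends of an edge can be chosen
    independently, as the potential absorbs their ratio. *)
Lemma exists_sum_le_energy (R : realType) (T : finType) (e : rel T) (a b : T) :
  symmetric e -> irreflexive e -> (forall x, exists y, e x y) -> e a b ->
  exists s : T -> T -> R[i],
    (forall x y, `|s x y| = 1 /\ s y x = (s x y)^-1) /\
    forall f : T -> R[i],
      `|\sum_x f x| ^+ 2 *+ 2 <= #|T|.-1%:R * magnetic_energy e s f.
Proof.
move=> e_sym e_irr e_nbr eab.
have [F [F_sym F_e F_nbr F_card]] := small_edge_cover e_sym e_irr e_nbr eab.
have [u u_spec] := choice (fun x => unit_norm_sum1_set R[i] (F_nbr x)).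
have u1 x y : `|u x y| = 1 by have [] := u_spec x.
have uS x : \sum_(y | F x y) u x y = 1 by have [] := u_spec x.
have u_neq0 x y : u x y != 0 by rewrite -normr_gt0 u1.
pose s x y := - (u y x / u x y).
exists s; split => [x y|f].
  split; first by rewrite normrN normrM normfV !u1 divr1.
  by rewrite /s invrN invf_div.
pose z x y := u x y * f x + u y x * f y.
have normzE x y : `|z x y| = `|f x - s x y * f y|.
  rewrite -[RHS]mul1r -(u1 x y) -normrM /z /s; congr `|_|.
  by field; apply: u_neq0.
have SE : (\sum_x f x) *+ 2 = \sum_x \sum_(y | F x y) z x y.
  under [RHS]eq_bigr do rewrite big_split; rewrite big_split /=.
  rewrite (sum_edges_swap (fun x y => u x y * f x)) // mulr2n.
  suff -> : \sum_x \sum_(y | F x y) u x y * f x = \sum_x f x by [].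
  by apply: eq_bigr => x _; rewrite -mulr_suml uS mul1r.
have FE : \sum_x \sum_(y | F x y) `|z x y| ^+ 2 <= magnetic_energy e s f.
  apply: ler_sum => x _; rewrite big_mkcond [leRHS]big_mkcond /=.
  apply: ler_sum => y _; rewrite normzE; case: ifP => [/F_e->|_] //.
  by case: ifP => // _; rewrite exprn_ge0.
have := sqr_norm_sum_le [pred v : T * T | F v.1 v.2] (fun v => z v.1 v.2).
rewrite -(pair_big_dep xpredT F z).
rewrite -(pair_big_dep xpredT F (fun x y => `|z x y| ^+ 2)).
rewrite /= -SE => S_le.
have {}S_le : `|\sum_x f x| ^+ 2 *+ 4 <= #|T|.-1.*2%:R * magnetic_energy e s f.
  have -> : `|\sum_x f x| ^+ 2 *+ 4 = `|(\sum_x f x) *+ 2| ^+ 2.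
    by rewrite normrMn exprMn_n.
  apply: le_trans S_le _; apply: ler_pM => //; rewrite ?ler_nat //.
  by do 2![apply: sumr_ge0 => ? _]; rewrite exprn_ge0.
suff : `|\sum_x f x| ^+ 2 *+ 2 *+ 2 <= #|T|.-1%:R * magnetic_energy e s f *+ 2.
  by rewrite lerMn2r.
by rewrite -mulrnA -mulrnAl -mulrnA !muln2.
Qed.

(** With value 1 on the suspension edges, energy - 2 |f|^2 is a quadratic
    polynomial in the value c of f at the new vertex, and the bound on the sum
    of f over the graph says that its discriminant is nonpositive. *)
Lemma no_isolated_suspension_height_ge1 (R : realType) (T : finType)
    (e : rel T) :
  symmetric e -> irreflexive e -> (0 < #|T|)%N ->
  (forall x, exists y, e x y) ->
  1 <= magneto_spectral_height R (suspension e).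
Proof.
move=> e_sym e_irr /card_gt0P[a _] e_nbr; have [b eab] := e_nbr a.
have [s0 [s0_pot s0_sum]] := exists_sum_le_energy R e_sym e_irr e_nbr eab.
pose s (v w : option T) : R[i] :=
  if v is Some x then if w is Some y then s0 x y else 1 else 1.
have s_pot : magnetic_potential (suspension e) s.
  by case=> [x|] [y|] //= _; rewrite ?normr1 ?invr1.
have es_sym := suspension_sym e_sym.
apply: le_trans _ (height_ge (card_suspension_gt0 T) es_sym s_pot).
apply: (lambda1_ge (card_suspension_gt0 T) es_sym s_pot) => f.
rewrite suspension_energyE // big_option rmorph1 mul1r.
pose g x := f (Some x); pose c := f None.
have := s0_sum g.
set E := magnetic_energy _ _ _.
have T_gt1 : (0 < #|T|.-1)%N.
  have := max_card [set a; b].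
  by rewrite cards2; case: eqVneq eab => [->|_ _]; [rewrite e_irr|lia].
have N_gt0 : 0 < #|T|.-1%:R :> R[i] by rewrite ltr0n.
have TE : #|T|%:R = #|T|.-1%:R + 1 :> R[i].
  by rewrite natr1 prednK //; lia.
move: N_gt0 TE; set N : R[i] := #|T|.-1%:R => N_gt0 TE.
set S := \sum_x g x => S_le.
have distE : \sum_x `|f (Some x) - s (Some x) None * f None| ^+ 2 =
    \sum_x `|f (Some x)| ^+ 2 - c^* * S - c * S^* + (N + 1) * `|c| ^+ 2.
  under eq_bigr do rewrite mul1r normCK rmorphB /=.
  under [in RHS]eq_bigr do rewrite normCK.
  rewrite normCK /S rmorph_sum /= -TE !mulr_sumr -!sumrB mulrC mulr_natr.
  rewrite -sumr_const -big_split /=; apply: eq_bigr => x _.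
  by rewrite /g /c; ring.
(* multiplying by N turns the left-hand side into a square plus the slack in
   [S_le] *)
rewrite distE -subr_ge0 -(pmulr_rge0 _ N_gt0).
rewrite -/c; set Q := \sum_x _.
apply: (@le_trans _ _ (`|N * c - S| ^+ 2 *+ 2 + (N * E - `|S| ^+ 2 *+ 2))).
  by rewrite addr_ge0 ?subr_ge0 // mulrn_wge0 // exprn_ge0.
rewrite le_eqVlt; apply/orP; left; apply/eqP.
rewrite !normCK rmorphB rmorphM /= (CrealP (gtr0_real N_gt0)).
by ring.
Qed.

(** * Positivity of the height *)

(** The suspension is then a star, and copying the value at the centre along
    each edge through the potential gives a function of energy 0. *)
Lemma edgeless_suspension_height_le0 (R : realType) (T : finType)
    (e : rel T) :
  (forall x y, ~~ e x y) -> magneto_spectral_height R (suspension e) <= 0.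
Proof.
move=> e0; apply: height_le => s s_pot.
have e_sym : symmetric (suspension e).
  by apply: suspension_sym => x y; rewrite !(negPf (e0 _ _)).
pose f u := if u is Some x then s (Some x) None else 1.
apply: (lambda1_le (f := f) (card_suspension_gt0 T) _ s_pot) => //.
  by apply: (@sum_sqr_norm_gt0 _ _ f None); rewrite oner_eq0.
rewrite suspension_energyE // /magnetic_energy rmorph0 mul0r mul0rn.
rewrite big1 => [|x _].
  rewrite mul0rn add0r big1 // => x _.
  by rewrite big_pred0 // => y; exact/negbTE/e0.
by rewrite mulr1 subrr normr0 expr0n.
Qed.

(** Putting -1 on ab and 1 elsewhere, a function of energy 0 is constant because
    of the suspension edges, and the edge ab makes that constant equal to its
    opposite. *)
Lemma edge_suspension_height_gt0 (R : realType) (T : finType) (e : rel T)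
    (a b : T) :
  symmetric e -> irreflexive e -> e a b ->
  0 < magneto_spectral_height R (suspension e).
Proof.
move=> e_sym e_irr eab.
pose neg (u v : option T) := (u == Some a) && (v == Some b).
pose s u v : R[i] := if neg u v || neg v u then -1 else 1.
have s_pot : magnetic_potential (suspension e) s.
  move=> u v _; rewrite /s orbC.
  by case: ifP; rewrite ?normrN normr1 ?invrN invr1.
have es_sym := suspension_sym e_sym.
apply: lt_le_trans _ (height_ge (card_suspension_gt0 T) es_sym s_pot).
apply: (lambda1_gt0 (card_suspension_gt0 T) es_sym s_pot) => f f_eq.
have fE x : f (Some x) = f None.
  by rewrite (f_eq (Some x) None) // /s /neg /= !andbF mul1r.
have f0 : f None = 0.
  have := f_eq (Some a) (Some b) eab.
  rewrite /s /neg !eqxx /= !fE mulN1r => /eqP.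
  by rewrite -addr_eq0 -mulr2n mulrn_eq0 /= => /eqP.
by case=> [x|]; rewrite ?fE f0.
Qed.

Theorem proposition4p18 (R : realType) (T : finType) (e : rel T)
    (e_sym : symmetric e) (e_irr : irreflexive e) (T_gt0 : (0 < #|T|)%N) :
  (magneto_spectral_height R (suspension e) < 1 <->
     exists x : T, isolated e x) /\
  (0 < magneto_spectral_height R (suspension e) < 1 <->
     (exists x : T, isolated e x) /\ (exists x y : T, e x y)).
Proof.
have lt1P : magneto_spectral_height R (suspension e) < 1 <->
    exists x : T, isolated e x.
  split => [|[x]]; last exact: isolated_suspension_height_lt1.
  apply: contraPP => no_iso; apply/negP; rewrite -leNgt.
  apply: no_isolated_suspension_height_ge1 => // x.
  apply: contrapT => x_iso; apply: no_iso; exists x => y.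
  by apply/negP => exy; apply: x_iso; exists y.
split => //; split => [/andP[gt0 /lt1P iso]|[iso [x [y exy]]]]; last first.
  by rewrite (edge_suspension_height_gt0 R e_sym e_irr exy); apply/lt1P.
split => //; apply: contrapT => no_edge; move: gt0; apply/negP.
rewrite -leNgt; apply: edgeless_suspension_height_le0 => x y.
by apply/negP => exy; apply: no_edge; exists x, y.
Qed.
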